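(* Let $K$ be a ring with $0_K\neq 1_K$, let $A$ be an alphabet, and let $\equiv$ be a finitely generated congruence on $A^*$ which is $K$-shuffle compatible and which is generated by relators of the form $u\equiv v$ ($u,v\in A^*$) where $u-v$ is a primitive element of $K\langle A\rangle$. Then one of the following holds: 1. The monoid $A^*/_\equiv$ is not cancellable. 2. There exists a weight function $\omega:A\to\mathbb N\setminus\{0\}$ for which $\equiv$ is homogeneous, and $A^*/_\equiv$ embeds in a group.
   Context: $A^*$ is the free monoid on the alphabet (set) $A$, with empty word $1$. A congruence on $A^*$ is an equivalence relation compatible with concatenation on both sides; it is finitely generated if it is generated by a finite subset of $A^*\times A^*$. For a monoid $M$, $K[M]$ is the monoid algebra (finitely supported functions $M\to K$, scalars commuting with elements of $M$), and $K\langle A\rangle=K[A^*]$. The tensor product $K[M]\otimes K[M]$ is the algebra with $K$-basis $\{m\otimes m' : m,m'\in M\}$ and product $(m\otimes m')(n\otimes n')=mn\otimes m'n'$. The coproduct $c:K\langle A\rangle\to K\langle A\rangle\otimes K\langle A\rangle$ dual to the shuffle product is the $K$-linear multiplicative map with $c(1)=1\otimes 1$ and $c(a)=a\otimes 1+1\otimes a$ for $a\in A$. Let $nat:K\langle A\rangle\to K[A^*/_\equiv]$ be the linear extension of the quotient map. The congruence $\equiv$ is $K$-shuffle compatible if there is a $K$-linear map $c_\equiv:K[A^*/_\equiv]\to K[A^*/_\equiv]\otimes K[A^*/_\equiv]$ with $c_\equiv\circ nat=(nat\otimes nat)\circ c$. An element $P\in K\langle A\rangle$ is primitive if $c(P)=P\otimes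 1+1\otimes P$. A monoid is cancellable if $xy=xz\Rightarrow y=z$ and $yx=zx\Rightarrow y=z$ for all elements $x,y,z$. A function $\omega:A\to\mathbb N\setminus\{0\}$ is extended to $A^*$ by $\omega(w)=\sum_{a}|w|_a\,\omega(a)$, where $|w|_a$ is the number of occurrences of $a$ in $w$. The congruence $\equiv$ is homogeneous for $\omega$ if $u\equiv v$ implies $\omega(u)=\omega(v)$ for all $u,v\in A^*$. *)

(* Defs.v *)
From HB Require Import structures.
From mathcomp Require Import all_boot all_order all_algebra.
From mathcomp Require Import finmap.
From mathcomp Require Import boolp.
From mathcomp.multinomials Require Import monalg.

Set Implicit Arguments.
Unset Strict Implicit.
Unset Printing Implicit Defensive.

Import GRing.Theory.

Local Open Scope ring_scope.
Local Open Scope quotient_scope.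

Local Notation "1" := (@mone _) : monom_scope.
Local Notation "x * y" := (mmul x y) : monom_scope.

(* The monoid A^* is [{fmonom A}], with unit [1%M] and concatenation [_ * _]%M.
   K[X] is [{malg K[X]}], a left K-module for every choiceType X; monalg makes
   it a ring only when X is a [monomType], i.e. a monoid in which 1 is the only
   invertible element, which is the case of A^* and of A^* x A^*. *)

Section ProdMonom.
Variables M N : monomType.

Definition prod_mone : M * N := (1%M, 1%M).
Definition prod_mmul (x y : M * N) : M * N := ((x.1 * y.1)%M, (x.2 * y.2)%M).

Lemma prod_mmulA : associative prod_mmul.
Proof. by move=> x y z; rewrite /prod_mmul /= !mulmA. Qed.

Lemma prod_mul1m : left_id prod_mone prod_mmul.
Proof. by case=> x y; rewrite /prod_mmul /= !mul1m. Qed.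

Lemma prod_mulm1 : right_id prod_mone prod_mmul.
Proof. by case=> x y; rewrite /prod_mmul /= !mulm1. Qed.

Lemma prod_unitm x y :
  prod_mmul x y = prod_mone -> x = prod_mone /\ y = prod_mone.
Proof.
by case: x y => [x1 x2] [y1 y2] [] /unitm[-> ->] /unitm[-> ->].
Qed.

HB.instance Definition _ := Choice_isMonomialDef.Build (M * N)%type
  prod_mmulA prod_mul1m prod_mulm1 prod_unitm.
End ProdMonom.

Section LinearExtension.
Variables (K : nzRingType) (X : choiceType) (V : lmodType K) (h : X -> V).

Definition linext (P : {malg K[X]}) : V := \sum_(x <- msupp P) P@_x *: h x.

Lemma linextEw (d : {fset X}) (P : {malg K[X]}) :
  (msupp P `<=` d)%fset -> linext P = \sum_(x <- d) P@_x *: h x.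
Proof.
move=> le; rewrite /linext (big_fset_incl _ le) //= => x _ /mcoeff_outdom ->.
by rewrite scale0r.
Qed.

Lemma linext_is_linear : linear linext.
Proof.
move=> c P Q; pose d := (msupp P `|` msupp Q)%fset.
have leP : (msupp P `<=` d)%fset by exact: fsubsetUl.
have leQ : (msupp Q `<=` d)%fset by exact: fsubsetUr.
have leD : (msupp (c *: P + Q) `<=` d)%fset.
  apply: fsubset_trans (msuppD_le _ _) _; rewrite fsubUset leQ andbT.
  exact: fsubset_trans (msuppZ_le _ _) leP.
rewrite (linextEw leP) (linextEw leQ) (linextEw leD) scaler_sumr -big_split /=.
by apply: eq_bigr => x _; rewrite mcoeffD mcoeffZ scalerDl scalerA.
Qed.

HB.instance Definition _ :=
  GRing.isLinear.Build K {malg K[X]} V *:%R linext linext_is_linear.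

Lemma linextU x : linext << x >> = h x.
Proof. by rewrite (linextEw msuppU_le) big_seq_fset1 mcoeffUU scale1r. Qed.
End LinearExtension.

(* K[X] (x) K[Y] is K[X x Y]: the basis vector x (x) y is << (x, y) >>. *)
Section Tensor.
Variable K : nzRingType.

Definition tensor (X Y : choiceType) (P : {malg K[X]}) (Q : {malg K[Y]}) :
    {malg K[(X * Y)%type]} :=
  \sum_(x <- msupp P) \sum_(y <- msupp Q) << P@_x * Q@_y *g (x, y) >>.

Definition tensor_map (X Y X' Y' : choiceType)
    (f : {malg K[X]} -> {malg K[X']}) (g : {malg K[Y]} -> {malg K[Y']}) :
    {malg K[(X * Y)%type]} -> {malg K[(X' * Y')%type]} :=
  linext (fun p => tensor (f << p.1 >>) (g << p.2 >>)).
End Tensor.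

Section Coproduct.
Variables (K : nzRingType) (A : choiceType).

Definition coprod_letter (a : A) : {malg K[({fmonom A} * {fmonom A})%type]} :=
  tensor << fmu a >> 1 + tensor 1 << fmu a >>.

Definition coprod_word (w : {fmonom A}) : {malg K[({fmonom A} * {fmonom A})%type]} :=
  \prod_(a <- (w : seq A)) coprod_letter a.

(* The linear map [coprod] is the coproduct dual to the shuffle product: it is
   characterized by [coprod1], [coprodU] and [coprodM]. *)
Definition coprod : {malg K[{fmonom A}]} -> {malg K[({fmonom A} * {fmonom A})%type]} :=
  linext coprod_word.

Definition primitive (P : {malg K[{fmonom A}]}) : Prop :=
  coprod P = tensor P 1 + tensor 1 P.

Lemma coprod1 : coprod 1 = tensor 1 1.
Proof.
rewrite /coprod linextU /coprod_word fm1 big_nil /tensor !msuppU1 !big_seq_fset1.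
by rewrite !mcoeffUU mulr1.
Qed.

Lemma coprodU a : coprod << fmu a >> = coprod_letter a.
Proof. by rewrite /coprod linextU /coprod_word fmuE big_seq1. Qed.

Lemma coprodM P Q : coprod (P * Q) = coprod P * coprod Q.
Proof.
have wordM u v : coprod_word (u * v)%M = coprod_word u * coprod_word v.
  by rewrite /coprod_word -big_cat fmM.
have commACA (S : nzRingType) (a b c d : S) :
    GRing.comm b c -> a * b * (c * d) = a * c * (b * d).
  by move=> bc; rewrite mulrA -(mulrA a) bc !mulrA.
have letterC a (x : K) : GRing.comm (x%:MP) (coprod_letter a).
  have one_comm k : x%:MP * << k >> = << k >> * x%:MP
      :> {malg K[({fmonom A} * {fmonom A})%type]}.
    apply: etrans (fgmulUU _ _ _ _) (esym (etrans (fgmulUU _ _ _ _) _)).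
    by rewrite mulr1 mul1r mul1m mulm1.
  rewrite /coprod_letter /tensor !msuppU1 !big_seq_fset1 !mcoeffUU !mulr1.
  by apply: commrD; apply: one_comm.
have wordZ u v (x y : K) : (x * y) *: (coprod_word u * coprod_word v) =
    (x *: coprod_word u) * (y *: coprod_word v).
  have yC : GRing.comm (y%:MP) (coprod_word u) by apply: commr_prod => a _.
  rewrite -[LHS]mul_malgC rmorphM -[x *: _]mul_malgC -[y *: _]mul_malgC.
  exact: commACA.
rewrite malgME /coprod linear_sum {2}/linext mulr_suml; apply: eq_bigr => u _.
rewrite linear_sum mulr_sumr; apply: eq_bigr => v _.
by rewrite /= (linextEw _ msuppU_le) big_seq_fset1 mcoeffUU wordM wordZ.
Qed.
End Coproduct.

Record congruence (A : choiceType) := Congruence {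
  congr_rel :> {fmonom A} -> {fmonom A} -> Prop;
  congr_refl : forall u, congr_rel u u;
  congr_sym : forall u v, congr_rel u v -> congr_rel v u;
  congr_trans : forall u v w, congr_rel u v -> congr_rel v w -> congr_rel u w;
  congr_mull : forall w u v, congr_rel u v -> congr_rel (w * u)%M (w * v)%M;
  congr_mulr : forall w u v, congr_rel u v -> congr_rel (u * w)%M (v * w)%M
}.

Definition generated_by (A : choiceType) (E : congruence A)
    (R : {fmonom A} -> {fmonom A} -> Prop) : Prop :=
  (forall u v, R u v -> E u v) /\
  (forall F : congruence A,
     (forall u v, R u v -> F u v) -> forall u v, E u v -> F u v).

Definition finitely_generated (A : choiceType) (E : congruence A) : Prop :=
  exists s : seq ({fmonom A} * {fmonom A}),
    generated_by E (fun u v => (u, v) \in s).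

Section QuotientMonoid.
Variables (A : choiceType) (E : congruence A).

(* Congruences need not be decidable: [`[< _ >]] is the classical truth value. *)
Definition congr_bool (u v : {fmonom A}) : bool := `[< E u v >].

Lemma congr_bool_refl : reflexive congr_bool.
Proof. by move=> u; apply/asboolP/congr_refl. Qed.

Lemma congr_bool_sym : symmetric congr_bool.
Proof. by move=> u v; apply/asboolP/asboolP; exact: congr_sym. Qed.

Lemma congr_bool_trans : transitive congr_bool.
Proof.
move=> v u w /asboolP uv /asboolP vw; apply/asboolP; exact: congr_trans uv vw.
Qed.

Canonical congr_equiv :=
  EquivRel congr_bool congr_bool_refl congr_bool_sym congr_bool_trans.

Definition quot := {eq_quot congr_equiv}.
HB.instance Definition _ := Choice.on quot.

Definition quot_pi (u : {fmonom A}) : quot := \pi_{eq_quot congr_equiv} u.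

Definition quot_one : quot := quot_pi 1%M.
Definition quot_mul (x y : quot) : quot :=
  quot_pi (repr (x : {eq_quot congr_equiv}) *
           repr (y : {eq_quot congr_equiv}))%M.

Lemma quot_piP u v : quot_pi u = quot_pi v <-> E u v.
Proof.
split=> [/eqP|uv]; first by rewrite /quot_pi eqmodE => /asboolP.
by apply/eqP; rewrite /quot_pi eqmodE; apply/asboolP.
Qed.

Lemma quot_ind (P : quot -> Prop) : (forall u, P (quot_pi u)) -> forall x, P x.
Proof. by move=> Ppi x; rewrite -[x]reprK; exact: Ppi. Qed.

Lemma quot_mulE u v : quot_mul (quot_pi u) (quot_pi v) = quot_pi (u * v)%M.
Proof.
have reprE w : E (repr (quot_pi w : {eq_quot congr_equiv})) w.
  by apply/quot_piP; rewrite /quot_pi reprK.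
apply/quot_piP; apply: congr_trans (congr_mulr _ (reprE u)) _.
exact: congr_mull.
Qed.

Lemma quot_mulA : associative quot_mul.
Proof.
elim/quot_ind=> u; elim/quot_ind=> v; elim/quot_ind=> w.
by rewrite !quot_mulE mulmA.
Qed.

Lemma quot_mul1 : left_id quot_one quot_mul.
Proof. by elim/quot_ind=> u; rewrite quot_mulE mul1m. Qed.

Lemma quot_mulr1 : right_id quot_one quot_mul.
Proof. by elim/quot_ind=> u; rewrite quot_mulE mulm1. Qed.

HB.instance Definition _ := isMonoid.Build quot quot_mulA quot_mul1 quot_mulr1.
End QuotientMonoid.

Definition nat_quot (K : nzRingType) (A : choiceType) (E : congruence A) :
    {malg K[{fmonom A}]} -> {malg K[quot E]} :=
  linext (fun w => << quot_pi E w >>).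

Definition shuffle_compatible (K : nzRingType) (A : choiceType)
    (E : congruence A) : Prop :=
  exists cE : {linear {malg K[quot E]} -> {malg K[(quot E * quot E)%type]}},
    forall P : {malg K[{fmonom A}]},
      cE (nat_quot E P) =
      tensor_map (@nat_quot K A E) (@nat_quot K A E) (coprod P).

Definition cancellable (M : monoidType) : Prop :=
  (forall x y z : M, (x * y = x * z)%g -> y = z) /\
  (forall x y z : M, (y * x = z * x)%g -> y = z).

Definition embeds_in_group (M : monoidType) : Prop :=
  exists (G : groupType) (f : UMagmaMorphism.type M G), injective f.

(* The letters that do not occur in w contribute 0 to the sum over A. *)
Definition word_weight (A : choiceType) (omega : A -> nat) (w : {fmonom A}) :
    nat :=
  (\sum_(a <- undup w) count_mem a w * omega a)%N.

Definition homogeneous (A : choiceType) (omega : A -> nat)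
    (E : congruence A) : Prop :=
  forall u v, E u v -> word_weight omega u = word_weight omega v.

(* Main.v *)
(* Let M = A^*/E.

   If u - v is primitive, applying a linear form to
   c(u) - c(v) = (u - v) (x) 1 + 1 (x) (u - v) shows that, modulo u - v, the sum
   of all subwords of u equals that of v.  Hence, as in the Magnus embedding,
   a |-> 1 + a is compatible with the relators, and w acts as the sum of its
   subwords.  Once M is graded by a positive weight, 1 + a is invertible on the
   functions M -> K of bounded support, and the term of highest weight in the
   action of w is w itself, so M embeds in a group of bijections.

   As for the weight: if u - v is primitive and u, v are not anagrams, then u
   and v are powers of letters, since the coefficient of a^k (x) (u without a)
   in c(u) is 1.  When M is cancellable, a^m == a^n forces m = n, so the
   relations a^m == b^n determine consistent ratios of weights; finitely many
   relators suffice, so denominators can be cleared. *)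
Require Import Defs.
From HB Require Import structures.
From mathcomp Require Import all_boot all_algebra.
From mathcomp Require Import finmap boolp ring zify.
From mathcomp.multinomials Require Import monalg.

Set Implicit Arguments.
Unset Strict Implicit.
Unset Printing Implicit Defensive.

Import GRing.Theory.

Local Open Scope ring_scope.

(** * Tensors and products of basis vectors *)

Lemma malgUZ (K : nzRingType) (X : choiceType) (c : K) (x : X) :
  << c *g x >> = c *: << x >>.
Proof. by apply/malgP => y; rewrite mcoeffZ !mcoeffU mulr_natr. Qed.

Lemma linextUB (K : nzRingType) (X : choiceType) (V : lmodType K) (h : X -> V)
    (x y : X) :
  linext h (<< x >> - << y >>) = h x - h y.
Proof. by rewrite raddfB /= !linextU. Qed.

Lemma tensorUBl (K : nzRingType) (X Y : choiceType) (x x' : X) (y : Y) :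
  tensor (<< x >> - << x' >> : {malg K[X]}) << y >> =
  << (x, y) >> - << (x', y) >>.
Proof.
(* The support of the difference depends on whether [x = x']; a [linext] of the same difference
   avoids computing it. *)
rewrite -(linextUB (fun x => << (x, y) >>)) /tensor /linext.
apply: eq_bigr => z _.
by rewrite msuppU oner_eq0 big_seq_fset1 mcoeffUU mulr1 malgUZ.
Qed.

Lemma tensorUBr (K : nzRingType) (X Y : choiceType) (x : X) (y y' : Y) :
  tensor << x >> (<< y >> - << y' >> : {malg K[Y]}) =
  << (x, y) >> - << (x, y') >>.
Proof.
rewrite -(linextUB (fun y => << (x, y) >>)) /tensor /linext msuppU oner_eq0 big_seq_fset1.
by apply: eq_bigr => z _; rewrite mcoeffUU mul1r malgUZ.
Qed.

(** With [x = (a, 1)] and [y = (1, a)] this is the induction step that expands the coproduct of a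
    word. *)
Lemma malg_mulUD_sum (K : nzRingType) (M : monomType) (x y : M) (s : seq M) :
  (<< x >> + << y >>) * \sum_(z <- s) << z >> =
  \sum_(z <- [seq mmul x z | z <- s] ++ [seq mmul y z | z <- s]) << z >>
  :> {malg K[M]}.
Proof.
have mulU z t : << z >> * << t >> = << mmul z t >> :> {malg K[M]}.
  by apply: etrans (fgmulUU _ _ _ _) _; rewrite mulr1.
rewrite big_cat !big_map mulrDl !mulr_sumr.
by congr (_ + _); apply: eq_bigr => z _; rewrite mulU.
Qed.

(** * Splittings of a word into complementary subwords *)

Section Splittings.
Variable A : choiceType.
Implicit Types (w : {fmonom A}) (s : seq A).

(* All pairs (x, y) of complementary subwords, with multiplicity. *)
Fixpoint splits s : seq ({fmonom A} * {fmonom A}) :=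
  if s is a :: s' then
    [seq (mmul (fmu a) p.1, p.2) | p <- splits s'] ++
    [seq (p.1, mmul (fmu a) p.2) | p <- splits s']
  else [:: (mone, mone)].

Lemma fmonom_eq w1 w2 : (w1 == w2) = (w1 == w2 :> seq A).
Proof. by []. Qed.

Lemma splits_perm s p : p \in splits s -> perm_eq (p.1 ++ p.2) s.
Proof.
elim: s p => [|a s IHs] p /=; first by rewrite inE => /eqP-> /=; rewrite fm1.
rewrite mem_cat => /orP[] /mapP[q /IHs qs ->] /=; rewrite fmM fmuE /=.
  by rewrite perm_cons.
by rewrite perm_catC /= perm_cons perm_catC.
Qed.

Lemma splits_cons a s :
  splits (a :: s) = [seq mmul (fmu a, mone) p | p <- splits s] ++
                    [seq mmul (mone, fmu a) p | p <- splits s].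
Proof.
by congr (_ ++ _); apply: eq_map => p; rewrite [RHS]surjective_pairing /= mul1m.
Qed.

(** To reach this pair, every letter satisfying [q] must go left and every other letter right, so a
    single choice of positions produces it. *)
Lemma count_splits_filter (q : pred A) s :
  count_mem (FMonom (filter q s), FMonom (filter (predC q) s)) (splits s) = 1%N.
Proof.
elim: s => [|a s IHs] /=.
  by rewrite addn0 -pair_eqE /= !fmonom_eq fm1.
rewrite count_cat !count_map /=; case: ifPn => qa /=.
  rewrite -[RHS]addn0; congr (_ + _)%N.
    rewrite -[RHS]IHs; apply: eq_count => -[x y] /=; rewrite /= -!pair_eqE /=.
    by rewrite !fmonom_eq fmM fmuE /= eqseq_cons eqxx.
  apply/eqP; rewrite -leqn0 leqNgt -has_count; apply/hasPn => -[x y] _ /=.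
  rewrite -pair_eqE /= !fmonom_eq fmM fmuE /= negb_and; apply/orP; right.
  apply/eqP => ay; have : a \in filter (predC q) s by rewrite -ay inE eqxx.
  by rewrite mem_filter /= qa.
rewrite -[RHS]add0n; congr (_ + _)%N; last first.
  rewrite -[RHS]IHs; apply: eq_count => -[x y] /=; rewrite /= -!pair_eqE /=.
  by rewrite !fmonom_eq fmM fmuE /= eqseq_cons eqxx.
apply/eqP; rewrite -leqn0 leqNgt -has_count; apply/hasPn => -[x y] _ /=.
rewrite -pair_eqE /= !fmonom_eq fmM fmuE /= negb_and; apply/orP; left.
apply/eqP => ay; have : a \in filter q s by rewrite -ay inE eqxx.
by rewrite mem_filter (negPf qa).
Qed.

End Splittings.

(** * Words whose difference is primitive *)

Section Primitive.
Variables (K : nzRingType) (A : choiceType).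
Implicit Types u v w : {fmonom A}.

Lemma coprod_letterE (a : A) :
  coprod_letter K a = << (fmu a, mone) >> + << (mone, fmu a) >>.
Proof.
by rewrite /coprod_letter /tensor !msuppU1 !big_seq_fset1 !mcoeffUU mulr1.
Qed.

Lemma coprod_wordE w : coprod_word K w = \sum_(p <- splits w) << p >>.
Proof.
rewrite /coprod_word; elim: (w : seq A) => [|a s IHs].
  by rewrite big_nil big_seq1.
rewrite splits_cons big_cons IHs coprod_letterE.
exact: (malg_mulUD_sum K (fmu a, mone) (mone, fmu a)).
Qed.

(* The value of the linear form h at both sides of the equation
   c(u - v) = (u - v) (x) 1 + 1 (x) (u - v). *)
Definition split_primitive u v : Prop :=
  forall h : {fmonom A} * {fmonom A} -> K,
    \sum_(p <- splits u) h p - \sum_(p <- splits v) h p =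
    h (u, mone) - h (v, mone) + (h (mone, u) - h (mone, v)).

Lemma primitive_split u v :
  primitive (<< u >> - << v >> : {malg K[{fmonom A}]}) -> split_primitive u v.
Proof.
move=> uvP h; pose L := linext (h : _ -> K^o).
have sumE w : L (coprod_word K w) = \sum_(p <- splits w) h p.
  rewrite coprod_wordE /L linear_sum; apply: eq_bigr => p _; exact: linextU.
have cuv : coprod_word K u - coprod_word K v =
    (<< (u, mone) >> - << (v, mone) >>) + (<< (mone, u) >> - << (mone, v) >>).
  apply: etrans (esym (linextUB _ _ _)) (etrans uvP _).
  by congr (_ + _); [exact: tensorUBl | exact: tensorUBr].
rewrite -!sumE; apply: etrans (esym (raddfB L _ _)) _.
apply: etrans (congr1 L cuv) _; apply: etrans (raddfD L _ _) _.
by congr (_ + _); exact: linextUB.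
Qed.

Lemma split_primitive_sym u v : split_primitive u v -> split_primitive v u.
Proof. by move=> uv h; rewrite -opprB uv opprD !opprB. Qed.

Lemma sum_indicator (T : eqType) (s : seq T) (x : T) :
  \sum_(y <- s) (y == x)%:R = (count_mem x s)%:R :> K.
Proof.
elim: s => [|y s IHs]; first by rewrite big_nil.
by rewrite big_cons IHs /= natrD.
Qed.

Lemma bool_natr_inj : injective (fun b : bool => b%:R : K).
Proof.
move=> [] [] //= /eqP; first by rewrite oner_eq0.
by rewrite eq_sym oner_eq0.
Qed.

(** On the indicator of [(mone, mone)] the equation reads [d = d + d], where [d] is the difference
    of the two truth values in [K]; hence [d = 0]. *)
Lemma split_primitive_eq1 u v :
  split_primitive u v -> (u == mone) = (v == mone).
Proof.
move=> uv; have := uv (fun p => (p == (mone, mone))%:R).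
have count1 w : count_mem (mone, mone) (splits w) = (w == mone :> {fmonom A}).
  have [->|w1] := eqVneq w mone; first by rewrite fm1 /= eqxx.
  apply: count_memPn; apply: contraNN w1 => /splits_perm /=.
  by rewrite fm1 /= perm_sym => /perm_nilP w0; rewrite fmonom_eq w0 fm1.
rewrite !sum_indicator !count1 -!pair_eqE /= eqxx !andbT /=.
by rewrite -[LHS]addr0 => /addrI/esym/eqP; rewrite subr_eq0 => /eqP/bool_natr_inj.
Qed.

(** If [u] has a letter besides its first letter [a], separate the [a]'s from the rest. Both parts
    are nonempty, so the right side of the equation vanishes on this pair; it must then also split
    [v], making [v] an anagram of [u]. *)
Lemma split_primitive_power u v :
  split_primitive u v -> ~~ perm_eq u v -> u != mone ->
  exists a m, u = FMonom (nseq m.+1 a).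
Proof.
case: u => -[|a u] uv nuv u1; first by rewrite fmonom_eq fm1 eqxx in u1.
exists a; pose q := pred1 a; pose x := filter q (a :: u).
have [au|nau] := boolP (all q (a :: u)).
  exists (size u); apply: val_inj => /=.
  by apply/all_pred1P.
have x1 : FMonom x != mone by rewrite fmonom_eq fm1 /x /= eqxx.
pose y := filter (predC q) (a :: u).
have y1 : FMonom y != mone.
  by rewrite fmonom_eq fm1 /y -has_filter has_predC.
have := uv (fun p => (p == (FMonom x, FMonom y))%:R).
rewrite !sum_indicator count_splits_filter -!pair_eqE /=.
rewrite !(eq_sym mone) (negPf x1) (negPf y1) !andbF !subrr addr0.
case: (boolP ((FMonom x, FMonom y) \in splits v)) => [/splits_perm/=|/count_memPn->].
  rewrite (permPl (permEl (perm_filterC q (a :: u)))) => uvP.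
  by rewrite uvP in nuv.
by rewrite subr0 => /eqP; rewrite oner_eq0.
Qed.

End Primitive.

(** * The group of bijections of a type *)

Lemma sval_inj (T : Type) (P : T -> Prop) : injective (@sval T P).
Proof. by move=> [x Px] [y Py] /= xy; subst y; rewrite (Prop_irrelevance Px Py). Qed.

Lemma inj_surj_bijective (X Y : Type) (f : X -> Y) :
  injective f -> (forall y, exists x, f x = y) -> bijective f.
Proof.
move=> f_inj /choice[g gK]; exists g => // x.
by apply: f_inj; rewrite gK.
Qed.

Section Bijections.
Variable X : Type.

Definition bij := {f : X -> X | bijective f}.
HB.instance Definition _ := gen_eqMixin bij.
HB.instance Definition _ := gen_choiceMixin bij.

Lemma bij_ext (f g : bij) : sval f =1 sval g -> f = g.
Proof. by move=> fg; apply: sval_inj; apply/funext. Qed.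

Definition bij_one : bij := exist _ id (inv_bij (fun=> erefl)).
Definition bij_mul (f g : bij) : bij :=
  exist _ (sval f \o sval g) (bij_comp (svalP f) (svalP g)).

Lemma bij_inv_exists (f : bij) :
  exists g : bij, cancel (sval f) (sval g) /\ cancel (sval g) (sval f).
Proof. by case: f => f [g fK gK]; exists (exist _ g (Bijective gK fK)). Qed.

Definition bij_inv (f : bij) : bij := sval (cid (bij_inv_exists f)).

Lemma bij_mulA : associative bij_mul.
Proof. by move=> f g h; apply: bij_ext. Qed.
Lemma bij_mul1 : left_id bij_one bij_mul.
Proof. by move=> f; apply: bij_ext. Qed.
Lemma bij_mulr1 : right_id bij_one bij_mul.
Proof. by move=> f; apply: bij_ext. Qed.
Lemma bij_mulV : left_inverse bij_one bij_inv bij_mul.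
Proof.
by move=> f; apply: bij_ext => x; rewrite /bij_inv /=; case: cid => g [fK _] /=.
Qed.
Lemma bij_mulrV : right_inverse bij_one bij_inv bij_mul.
Proof.
by move=> f; apply: bij_ext => x; rewrite /bij_inv /=; case: cid => g [_ gK] /=.
Qed.

HB.instance Definition _ := isGroup.Build bij
  bij_mulA bij_mul1 bij_mulr1 bij_mulV bij_mulrV.
End Bijections.

(** * The action of words by subword sums, and the embedding *)

Lemma quot_piM (A : choiceType) (E : congruence A) (u v : {fmonom A}) :
  quot_pi E (mmul u v) = (quot_pi E u * quot_pi E v)%g.
Proof. exact/esym/quot_mulE. Qed.

Section SubwordSum.
Variables (K : nzRingType) (A : choiceType) (E : congruence A).
Implicit Types (s t : seq A) (f : quot E -> K) (x : quot E).

(* The letter a acts as 1 + R_a, where (R_a f) x = f (x a). *)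
Definition subword_sum s f x : K :=
  \sum_(p <- splits s) f (x * quot_pi E p.1)%g.

Lemma subword_sum_nil f x : subword_sum [::] f x = f x.
Proof. by rewrite /subword_sum big_seq1 [(_ * _)%g]mulg1. Qed.

Lemma subword_sum_cons a s f x :
  subword_sum (a :: s) f x =
  subword_sum s f (x * quot_pi E (fmu a))%g + subword_sum s f x.
Proof.
rewrite /subword_sum /= big_cat !big_map /=; congr (_ + _).
apply: eq_bigr => p _; congr (f _).
by rewrite quot_piM mulgA.
Qed.

(** Right translations of the argument compose in the order of the word, so concatenation acts as
    composition without reversal. *)
Lemma subword_sum_cat s t f x :
  subword_sum (s ++ t) f x = subword_sum s (subword_sum t f) x.
Proof.
elim: s x => [|a s IHs] x; first by rewrite subword_sum_nil.
by rewrite /= !subword_sum_cons !IHs.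
Qed.

Lemma subword_sum_primitive (u v : {fmonom A}) f x :
  split_primitive K u v -> E u v -> subword_sum u f x = subword_sum v f x.
Proof.
move=> uvP /quot_piP uv; apply/eqP; rewrite -subr_eq0; apply/eqP.
(* The test function reads only the first component: the terms at [(u, mone)] and [(v, mone)] agree
   since [u] and [v] have the same class, and the other two are both [f x]. *)
rewrite /subword_sum (uvP (fun p => f (x * quot_pi E p.1)%g)) /= uv.
by rewrite !subrr addr0.
Qed.

(** Acting equally is itself a congruence containing the relators, so it contains [E]. *)
Lemma subword_sum_congr (R : {fmonom A} -> {fmonom A} -> Prop) :
  (forall u v, R u v -> split_primitive K u v) -> generated_by E R ->
  forall u v, E u v -> subword_sum u =2 subword_sum v.
Proof.
move=> RP [RE Emin].
pose F (u v : {fmonom A}) := forall f x, subword_sum u f x = subword_sum v f x.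
have Ft u v w : F u v -> F v w -> F u w by move=> uv vw f x; rewrite uv.
have Fl w u v : F u v -> F (mmul w u) (mmul w v).
  move=> uv f x; rewrite !fmM !subword_sum_cat.
  by congr subword_sum; apply/funext => y.
have Fr w u v : F u v -> F (mmul u w) (mmul v w).
  by move=> uv f x; rewrite !fmM !subword_sum_cat.
pose C := @Congruence A F (fun u f x => erefl) (fun u v uv f x => esym (uv f x))
  Ft Fl Fr.
apply: (Emin C) => u v uv f x.
by apply: subword_sum_primitive (RP _ _ uv) (RE _ _ uv).
Qed.

Variable omega : A -> nat.
Hypothesis omega_gt0 : forall a, (0 < omega a)%N.
Hypothesis Ehom : homogeneous omega E.

Lemma word_weightE (w : {fmonom A}) :
  word_weight omega w = (\sum_(a <- (w : seq A)) omega a)%N.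
Proof.
rewrite /word_weight -[RHS]big_undup_iterop_count.
by apply: eq_bigr => a _; rewrite Monoid.iteropE iter_addn_0 mulnC.
Qed.

Lemma word_weightM (u v : {fmonom A}) :
  word_weight omega (mmul u v) = (word_weight omega u + word_weight omega v)%N.
Proof. by rewrite !word_weightE fmM big_cat. Qed.

Definition quot_weight x : nat := word_weight omega (generic_quotient.repr x).

Lemma quot_weight_pi u : quot_weight (quot_pi E u) = word_weight omega u.
Proof. by apply: Ehom; apply/quot_piP; rewrite /quot_pi generic_quotient.reprK. Qed.

Lemma quot_weightM x y :
  quot_weight (x * y)%g = (quot_weight x + quot_weight y)%N.
Proof.
elim/quot_ind: x => u; elim/quot_ind: y => v.
by rewrite -quot_piM !quot_weight_pi word_weightM.
Qed.

Definition bounded_support N f := forall x, (N <= quot_weight x)%N -> f x = 0.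

Lemma bounded_subword_sum N s f :
  bounded_support N f -> bounded_support N (subword_sum s f).
Proof.
move=> fN x xN; apply: big1 => p _; apply: fN.
by rewrite quot_weightM (leq_trans xN) ?leq_addr.
Qed.

(** Without a bound on the support, [1 + R_a] would kill any [f] with [f (x a) = - f x]. *)
Definition bounded_fun := {f : quot E -> K | exists N, bounded_support N f}.

Lemma subword_op_subproof s (f : bounded_fun) :
  exists N, bounded_support N (subword_sum s (sval f)).
Proof. by case: f => f [N fN]; exists N; exact: bounded_subword_sum. Qed.

Definition subword_op s (f : bounded_fun) : bounded_fun :=
  exist _ (subword_sum s (sval f)) (subword_op_subproof s f).

Lemma subword_sum1 a f x :
  subword_sum [:: a] f x = f (x * quot_pi E (fmu a))%g + f x.
Proof. by rewrite subword_sum_cons !subword_sum_nil. Qed.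

Lemma quot_weight_fmu a : quot_weight (quot_pi E (fmu a)) = omega a.
Proof. by rewrite quot_weight_pi word_weightE fmuE big_seq1. Qed.

(** Descending induction on weight: heavy elements lie outside both supports, and the value at
    [x a], which is heavier than [x], determines the value at [x]. *)
Lemma letter_op_inj a : injective (subword_op [:: a]).
Proof.
move=> f g /(congr1 sval) /= fg; apply: sval_inj; apply/funext => x.
case: f g fg => [f [N fN]] [g [M gM]] /= fg.
have [k] : exists k, (maxn N M <= quot_weight x + k)%N.
  by exists (maxn N M); rewrite leq_addl.
elim: k x => [|k IHk] x xk.
  by rewrite fN ?gM //; lia.
have := congr1 (fun h => h x) fg; rewrite !subword_sum1 IHk; first exact: addrI.
by have := omega_gt0 a; rewrite quot_weightM quot_weight_fmu; lia.
Qed.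

(* (1 + R)^-1 = 1 - (1 + R)^-1 R, and R lowers the bound on the support. *)
Lemma letter_op_surj a (f : bounded_fun) : exists g, subword_op [:: a] g = f.
Proof.
suff surj N f0 : bounded_support N f0 ->
    exists2 g, bounded_support N g & subword_sum [:: a] g = f0.
  case: f => f [N fN]; have [g gN gf] := surj N f fN.
  by exists (exist _ g (ex_intro _ N gN)); apply: sval_inj.
elim: N f0 => [|N IHN] f0 fN.
  (* Bound [0] means that [f0] vanishes everywhere, so it is its own preimage. *)
  exists f0 => //; apply/funext => x.
  by rewrite subword_sum1 !fN ?addr0.
pose Rf x := f0 (x * quot_pi E (fmu a))%g.
have RfN : bounded_support N Rf.
  move=> x xN; apply: fN; have := omega_gt0 a.
  by rewrite quot_weightM quot_weight_fmu; lia.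
have [h hN hf] := IHN Rf RfN; exists (fun x => f0 x - h x).
  by move=> x xN; rewrite fN // hN ?subr0 //; lia.
apply/funext => x; have := congr1 (fun h => h x) hf.
rewrite !subword_sum1 /Rf => hx.
by rewrite addrACA -opprD hx addrAC subrr add0r.
Qed.

Lemma subword_op_bij s : bijective (subword_op s).
Proof.
elim: s => [|a s IHs].
  apply: (eq_bij (inv_bij (fun f : bounded_fun => erefl))) => f; apply: sval_inj.
  by apply/funext => x /=; rewrite subword_sum_nil.
have ab := inj_surj_bijective (@letter_op_inj a) (letter_op_surj a).
apply: (eq_bij (bij_comp ab IHs)) => f; apply: sval_inj.
by apply/funext => x /=; rewrite -subword_sum_cat.
Qed.

Lemma subword_sum_top s f x :
  (forall y, (quot_weight y < quot_weight x + word_weight omega (FMonom s))%N ->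
     f y = 0) ->
  subword_sum s f x = f (x * quot_pi E (FMonom s))%g.
Proof.
elim: s x => [|a s IHs] x f0.
  have -> : FMonom [::] = mone :> {fmonom A} by apply: val_inj; rewrite /= fm1.
  by rewrite subword_sum_nil [(_ * _)%g]mulg1.
have as_mul : FMonom (a :: s) = mmul (fmu a) (FMonom s).
  by apply: val_inj; rewrite /= fmM fmuE.
have a_gt0 := omega_gt0 a.
have ww : word_weight omega (FMonom (a :: s)) =
    (omega a + word_weight omega (FMonom s))%N.
  by rewrite as_mul word_weightM !word_weightE fmuE big_seq1.
rewrite ww in f0.
rewrite subword_sum_cons !IHs.
- rewrite [X in _ + X]f0 ?addr0; last by rewrite quot_weightM quot_weight_pi; lia.
  by rewrite as_mul quot_piM mulgA.
- by move=> y yx; apply: f0; lia.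
- by move=> y; rewrite quot_weightM quot_weight_fmu => yx; apply: f0; lia.
Qed.

Lemma subword_op_inj (u v : {fmonom A}) : subword_op u = subword_op v -> E u v.
Proof.
wlog vu : u v / (word_weight omega v <= word_weight omega u)%N.
  move=> W uv; case/orP: (leq_total (word_weight omega v) (word_weight omega u)).
    by move=> /W; exact.
  by move=> /W vu; apply/congr_sym/vu.
(* Test both operators on the indicator of the class of the heavier word [u], at the identity: only
   the top terms survive, giving [1] for [u] and the truth value of [E u v] for [v]. *)
move=> uv; pose f (x : quot E) : K := (x == quot_pi E u)%:R.
have fb : bounded_support (word_weight omega u).+1 f.
  move=> x xu; rewrite /f; case: eqP => // xE.
  by move: xu; rewrite xE quot_weight_pi ltnn.
have top w : (word_weight omega w <= word_weight omega u)%N ->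
    subword_sum w f 1%g = f (quot_pi E w).
  case: w => w wu; rewrite subword_sum_top ?mul1g // => y.
  have -> : quot_weight 1%g = 0%N by rewrite quot_weight_pi word_weightE fm1 big_nil.
  rewrite add0n /f => yw; case: eqP => // yE.
  by move: yw; rewrite yE quot_weight_pi ltnNge wu.
pose f' : bounded_fun := exist _ f (ex_intro (bounded_support^~ f) _ fb).
have := congr1 (fun F => sval (F f') 1%g) uv.
rewrite /= !top // /f eqxx; case: eqP => [vuE _|_ /eqP]; last by rewrite oner_eq0.
by apply/quot_piP.
Qed.

Lemma homogeneous_embeds (R : {fmonom A} -> {fmonom A} -> Prop) :
  (forall u v, R u v -> split_primitive K u v) -> generated_by E R ->
  embeds_in_group (quot E).
Proof.
move=> RP ER; have Econgr := subword_sum_congr RP ER.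
pose phi (x : quot E) : bij bounded_fun :=
  exist _ _ (subword_op_bij (generic_quotient.repr x : {fmonom A})).
have phi_pi u : sval (phi (quot_pi E u)) = subword_op u.
  apply/funext => f; apply: sval_inj; apply/funext => x /=; apply: Econgr.
  by apply/quot_piP; rewrite /quot_pi generic_quotient.reprK.
have phiP : ((phi 1%g = 1%g) * {morph phi : x y / (x * y)%g})%type.
  split.
    apply: sval_inj; rewrite phi_pi; apply/funext => f; apply: sval_inj.
    by apply/funext => x /=; rewrite fm1 subword_sum_nil.
  elim/quot_ind=> u; elim/quot_ind=> v; apply: sval_inj.
  rewrite -quot_piM.
  rewrite -[RHS]/(sval (phi (quot_pi E u)) \o sval (phi (quot_pi E v))) !phi_pi.
  apply/funext => f; apply: sval_inj.
  by apply/funext => x /=; rewrite fmM subword_sum_cat.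
pose Phi : UMagmaMorphism.type (quot E) (bij bounded_fun) :=
  HB.pack phi (isUMagmaMorphism.Build _ _ phi phiP).
exists (bij bounded_fun), Phi; elim/quot_ind=> u; elim/quot_ind=> v /(congr1 sval).
by rewrite !phi_pi => /subword_op_inj/quot_piP.
Qed.

End SubwordSum.

(** * Extracting finitely many relators *)

Section FiniteSubset.
Variables (A : choiceType) (R : {fmonom A} -> {fmonom A} -> Prop).
Implicit Type r : seq ({fmonom A} * {fmonom A}).

Definition list_within r : Prop := forall p, p \in r -> R p.1 p.2.

Definition list_forces r (u v : {fmonom A}) : Prop :=
  forall F : congruence A, (forall p, p \in r -> F p.1 p.2) -> F u v.

(** Pairs forced by finite lists of relators form a congruence containing [R]; transitivity
    concatenates the lists. *)
Lemma generated_forces (E : congruence A) u v :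
  generated_by E R -> E u v -> exists2 r, list_within r & list_forces r u v.
Proof.
move=> [_ Emin].
pose F u v := exists2 r, list_within r & list_forces r u v.
have F1 u0 : F u0 u0.
  by exists [::] => [p|C _]; rewrite ?inE //; exact: congr_refl.
have Fs u0 v0 : F u0 v0 -> F v0 u0.
  by move=> [r rR rF]; exists r => // C /rF; exact: congr_sym.
have Ft u0 v0 w0 : F u0 v0 -> F v0 w0 -> F u0 w0.
  move=> [r rR rF] [t tR tF]; exists (r ++ t).
    by move=> p; rewrite mem_cat => /orP[/rR|/tR].
  move=> C rtC; apply: congr_trans (rF C _) (tF C _) => p pr;
    by apply: rtC; rewrite mem_cat pr ?orbT.
have Fl w0 u0 v0 : F u0 v0 -> F (mmul w0 u0) (mmul w0 v0).
  by move=> [r rR rF]; exists r => // C /rF; exact: congr_mull.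
have Fr w0 u0 v0 : F u0 v0 -> F (mmul u0 w0) (mmul v0 w0).
  by move=> [r rR rF]; exists r => // C /rF; exact: congr_mulr.
apply: (Emin (Congruence F1 Fs Ft Fl Fr)) => u0 v0 uv0.
exists [:: (u0, v0)] => [p|C]; first by rewrite inE => /eqP->.
by move=> /(_ (u0, v0)); apply; rewrite inE eqxx.
Qed.

(** The given finite generating set need not lie in [R], but each of its pairs follows from finitely
    many relators of [R]. *)
Lemma finite_subset_generates (E : congruence A) :
  finitely_generated E -> generated_by E R ->
  exists2 r, list_within r & forall u v, E u v -> list_forces r u v.
Proof.
move=> [s [sE smin]] ER.
suff [r rR rs] : exists2 r, list_within r &
    forall p, p \in s -> list_forces r p.1 p.2.
  by exists r => // u v uv C rC; apply: (smin C) uv => x y /rs /(_ C); exact.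
elim: s sE {smin} => [|[u v] s IHs] sE; first by exists [::] => p; rewrite inE.
have [|r rR rs] := IHs; first by move=> x y xys; apply: sE; rewrite inE xys orbT.
have [|t tR tuv] := generated_forces ER (u := u) (v := v).
  by apply: sE; rewrite inE eqxx.
exists (t ++ r) => [p|p]; first by rewrite mem_cat => /orP[/tR|/rR].
rewrite inE => /orP[/eqP->|/rs ps] C trC.
  by apply: tuv => q qt; apply: trC; rewrite mem_cat qt.
by apply: ps => q qr; apply: trC; rewrite mem_cat qr orbT.
Qed.

End FiniteSubset.

(** * Construction of a positive weight *)

Section Weight.
Variables (K : nzRingType) (A : choiceType) (E : congruence A).
Variable R : {fmonom A} -> {fmonom A} -> Prop.
Implicit Types (a b c : A) (u v w : {fmonom A}).
Hypothesis RP : forall u v, R u v -> split_primitive K u v.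
Hypothesis ER : generated_by E R.

Lemma congr_eq1 u v : E u v -> (u == mone) = (v == mone).
Proof.
pose F u v : Prop := (u == mone) = (v == mone).
have Fl w u0 v0 : F u0 v0 -> F (mmul w u0) (mmul w v0).
  by rewrite /F !fmM_eq1 => ->.
have Fr w u0 v0 : F u0 v0 -> F (mmul u0 w) (mmul v0 w).
  by rewrite /F !fmM_eq1 => ->.
have Ft u0 v0 w0 : F u0 v0 -> F v0 w0 -> F u0 w0 by rewrite /F => ->.
case: ER => _ Emin.
apply: (Emin (@Congruence A F (fun=> erefl) (fun _ _ => @esym _ _ _) Ft Fl Fr)).
by move=> u0 v0 /RP; exact: split_primitive_eq1.
Qed.

Hypothesis Ecan : cancellable (quot E).

Definition letter_pow (a : A) n : {fmonom A} := FMonom (nseq n a).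

Lemma letter_powD a m n :
  letter_pow a (m + n) = mmul (letter_pow a m) (letter_pow a n).
Proof. by apply: val_inj; rewrite /= fmM /= nseqD. Qed.

Lemma letter_powM a b m n k :
  E (letter_pow a m) (letter_pow b n) ->
  E (letter_pow a (m * k)) (letter_pow b (n * k)).
Proof.
move=> mn; elim: k => [|k IHk].
  by rewrite !muln0; exact: congr_refl.
rewrite !mulnS !letter_powD; apply: congr_trans (congr_mulr _ mn) _.
exact: congr_mull.
Qed.

(** Cancelling [a^m] leaves [a^(n-m)] congruent to the empty word, which is congruent only to
    itself. *)
Lemma letter_pow_inj a m n : E (letter_pow a m) (letter_pow a n) -> m = n.
Proof.
wlog le_mn : m n / (m <= n)%N.
  move=> W mn; case/orP: (leq_total m n) => /W; first exact.
  by move=> W'; apply/esym/W'/congr_sym.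
move=> mn; apply/eqP; rewrite eqn_leq le_mn -subn_eq0 /=.
have /quot_piP/congr_eq1 : quot_pi E (letter_pow a (n - m)) = quot_pi E mone.
  apply: (proj1 Ecan (quot_pi E (letter_pow a m))); rewrite -!quot_piM mulm1.
  by rewrite -letter_powD subnKC //; apply/quot_piP/congr_sym.
rewrite eqxx fmonom_eq fm1 -size_eq0 size_nseq.
exact.
Qed.

Definition commensurable (a b : A) : Prop :=
  exists m n, E (letter_pow a m.+1) (letter_pow b n.+1).

Lemma commensurable_refl a : commensurable a a.
Proof. by exists 0%N, 0%N; exact: congr_refl. Qed.

Lemma commensurable_sym a b : commensurable a b -> commensurable b a.
Proof. by move=> [m [n ab]]; exists n, m; exact: congr_sym. Qed.

Lemma commensurable_trans a b c :
  commensurable a b -> commensurable b c -> commensurable a c.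
Proof.
(* Raising the relations to the powers [k+1] and [n+1] makes them meet at [b^((n+1)(k+1))]; [.-1]
   undoes the shift of exponents. *)
move=> [m [n ab]] [k [l bc]]; exists (m.+1 * k.+1).-1, (l.+1 * n.+1).-1.
rewrite !prednK ?muln_gt0 //; apply: congr_trans (letter_powM k.+1 ab) _.
by rewrite mulnC; exact: letter_powM.
Qed.

(* A representative depending only on the commensurability class of a. *)
Definition class_letter a : A := choose (fun b => `[< commensurable a b >]) a.

Lemma class_letterP a : commensurable a (class_letter a).
Proof.
apply/asboolP/(@chooseP _ (fun b => `[< commensurable a b >])).
exact/asboolP/commensurable_refl.
Qed.

Lemma class_letter_eq a b : commensurable a b -> class_letter a = class_letter b.
Proof.
move=> ab; rewrite /class_letter.
have -> : (fun c => `[< commensurable a c >]) =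
    (fun c => `[< commensurable b c >]).
  apply/funext => c; apply/asboolP/asboolP; apply: commensurable_trans => //.
  exact: commensurable_sym.
by apply: choose_id; apply/asboolP => //;
  [exact: commensurable_sym | exact: commensurable_refl].
Qed.

Definition class_exps a := cid (class_letterP a).
Definition letter_den a : nat := (sval (class_exps a)).+1.
Definition letter_num a : nat := (sval (cid (svalP (class_exps a)))).+1.

Lemma class_expsP a :
  E (letter_pow a (letter_den a)) (letter_pow (class_letter a) (letter_num a)).
Proof. exact: svalP (cid (svalP (class_exps a))). Qed.

(* The weight of a is proportional to letter_num a / letter_den a. *)
Lemma power_relation_ratio a b m n :
  E (letter_pow a m.+1) (letter_pow b n.+1) ->
  (m.+1 * letter_num a * letter_den b = n.+1 * letter_num b * letter_den a)%N.
Proof.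
move=> ab; have cab : class_letter a = class_letter b.
  by apply: class_letter_eq; exists m, n.
(* All three relations are raised so as to share the exponent factor [letter_den a * letter_den b];
   chaining them compares two powers of one class letter. *)
have Ea := letter_powM (m.+1 * letter_den b) (class_expsP a).
have Eb := letter_powM (n.+1 * letter_den a) (class_expsP b).
have Eab := letter_powM (letter_den a * letter_den b) ab.
apply: (@letter_pow_inj (class_letter a)); rewrite {2}cab.
rewrite (mulnC m.+1) (mulnC n.+1) -!mulnA.
apply: congr_trans (congr_sym Ea) (congr_trans _ Eb).
rewrite (mulnCA (letter_den a)).
by rewrite (mulnCA (letter_den b)) (mulnC (letter_den b)).
Qed.

Lemma homogeneous_weight_exists :
  finitely_generated E ->
  exists omega : A -> nat, (forall a, (0 < omega a)%N) /\ homogeneous omega E.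
Proof.
move=> /finite_subset_generates/(_ ER)[r rR rE].
pose L : seq A := flatten [seq fmonom_val p.1 ++ fmonom_val p.2 | p <- r].
(* A common multiple of the denominators of all letters in the chosen relators. *)
pose D := (\prod_(a <- L) letter_den a)%N.
have den_dvd a : a \in L -> (letter_den a %| D)%N.
  by move=> aL; rewrite /D (big_rem a aL) dvdn_mulr.
have D_gt0 : (0 < D)%N by apply: prodn_gt0.
(* Letters outside [L] occur in no chosen relator, so any positive value would do. *)
pose omega a := if a \in L then (D %/ letter_den a * letter_num a)%N else 1%N.
have omega_gt0 a : (0 < omega a)%N.
  rewrite /omega; case: ifP => // aL.
  by rewrite muln_gt0 andbT divn_gt0 // dvdn_leq // den_dvd.
exists omega; split=> // u v /rE.
pose F u v : Prop := word_weight omega u = word_weight omega v.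
have Fl w u0 v0 : F u0 v0 -> F (mmul w u0) (mmul w v0).
  by rewrite /F !word_weightM => ->.
have Fr w u0 v0 : F u0 v0 -> F (mmul u0 w) (mmul v0 w).
  by rewrite /F !word_weightM => ->.
have Ft u0 v0 w0 : F u0 v0 -> F v0 w0 -> F u0 w0 by rewrite /F => ->.
move=> /(_ (@Congruence A F (fun=> erefl) (fun _ _ => @esym _ _ _) Ft Fl Fr)).
apply=> -[u0 v0] /= uv0; rewrite /F !word_weightE.
have uvR : R u0 v0 := rR _ uv0; have uvP := RP uvR.
(* Anagrams have equal weight; otherwise both words are powers of letters. *)
have [uv|nuv] := boolP (perm_eq u0 v0); first exact: perm_big.
have u1 : u0 != mone.
  apply: contraNN nuv => u1; move: (u1); rewrite (split_primitive_eq1 uvP).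
  by move: u1 => /eqP-> /eqP->.
have v1 : v0 != mone by rewrite -(split_primitive_eq1 uvP).
have [a [m ua]] := split_primitive_power uvP nuv u1.
rewrite perm_sym in nuv.
have [b [n vb]] := split_primitive_power (split_primitive_sym uvP) nuv v1.
have aL : a \in L.
  apply/flattenP; exists (u0 ++ v0); [by apply/mapP; exists (u0, v0)|].
  by rewrite mem_cat ua inE eqxx.
have bL : b \in L.
  apply/flattenP; exists (u0 ++ v0); [by apply/mapP; exists (u0, v0)|].
  by rewrite mem_cat vb inE eqxx orbT.
have uvE : E (letter_pow a m.+1) (letter_pow b n.+1).
  by case: ER => RE _; apply: RE; rewrite /letter_pow -ua -vb.
rewrite ua vb !big_nseq !iter_addn_0 /omega aL bL.
apply/eqP; rewrite -(@eqn_pmul2r (letter_den a * letter_den b)) ?muln_gt0 //; apply/eqP.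
have ratio := power_relation_ratio uvE.
transitivity (D * (m.+1 * letter_num a * letter_den b))%N.
  by rewrite -{2}(divnK (den_dvd _ aL)); ring.
by rewrite ratio -{1}(divnK (den_dvd _ bL)); ring.
Qed.

End Weight.

Theorem theorem2 (K : nzRingType) (A : choiceType) (E : congruence A)
    (Efg : finitely_generated E)
    (Esh : shuffle_compatible K E)
    (Eprim : exists R : {fmonom A} -> {fmonom A} -> Prop,
       (forall u v, R u v ->
          primitive (<< u >> - << v >> : {malg K[{fmonom A}]})) /\
       generated_by E R) :
  ~ cancellable (quot E) \/
  ((exists omega : A -> nat,
      (forall a, (0 < omega a)%N) /\ homogeneous omega E) /\
   embeds_in_group (quot E)).
Proof.
have [Ecan|] := EM (cancellable (quot E)); [right | by left].
have [R [Rprim ER]] := Eprim.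
have RP u v : R u v -> split_primitive K u v by move/Rprim/primitive_split.
have [omega [omega_gt0 Ehom]] := homogeneous_weight_exists RP ER Ecan Efg.
split; first by exists omega.
exact: homogeneous_embeds omega_gt0 Ehom _ RP ER.
Qed.
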